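(* For a finite group $R$, let $q(R)$ be the proportion, among all $2^{|R|}$ subsets $S\subseteq R$, of those $S$ for which $\mathrm{Aut}(\Gamma(R,S))$ acts primitively and not regularly on the vertex set of $\Gamma(R,S)$. Then $q(R)\to 0$ as $|R|\to\infty$.
   Context: For a finite group $R$ and $S\subseteq R$, the Cayley digraph $\Gamma(R,S)$ has vertex set $R$ and $(g,h)$ is an arc iff $hg^{-1}\in S$ (loops allowed); $R$ acts regularly on it by right multiplication. *)

(* Defs.v *)
From mathcomp Require Import all_boot all_order all_algebra all_fingroup all_solvable.
Set Implicit Arguments.
Unset Strict Implicit.
Unset Printing Implicit Defensive.

Import GroupScope.

Section DigraphAut.

Variables (T : finType) (e : rel T).

Definition digraph_aut : {set {perm T}} :=
  [set f : {perm T} | [forall x, forall y, e (f x) (f y) == e x y]].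

Lemma digraph_autP (f : {perm T}) :
  reflect (forall x y, e (f x) (f y) = e x y) (f \in digraph_aut).
Proof.
rewrite inE; apply: (iffP forallP) => [ef x y | ef x].
  by apply/eqP; have /forallP := ef x; apply.
by apply/forallP=> y; rewrite ef.
Qed.

Lemma digraph_aut_group_set : group_set digraph_aut.
Proof.
apply/group_setP; split=> [|f g /digraph_autP ef /digraph_autP eg].
  by apply/digraph_autP=> x y; rewrite !perm1.
by apply/digraph_autP=> x y; rewrite !permM eg ef.
Qed.

Canonical digraph_aut_group := Group digraph_aut_group_set.

End DigraphAut.

Section Regular.

Variables (aT : finGroupType) (sT : finType).
Variables (A : {set aT}) (S : {set sT}) (to : {action aT &-> sT}).

Definition regular_on :=
  [transitive A, on S | to] && [forall x in S, 'C_A[x | to] == 1].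

End Regular.

Arguments regular_on {aT sT} A%_g S%_g to%_act.

Section Cayley.

Variable R : finGroupType.

(* Arcs (g, h) of the Cayley digraph; S may contain 1, which gives loops. *)
Definition cayley (S : {set R}) : rel R := [rel g h | h * g^-1 \in S].

Definition prim_nonreg (S : {set R}) : bool :=
  let G := digraph_aut (cayley S) in
  [primitive G, on [set: R] | 'P] && ~~ regular_on G [set: R] 'P.

Definition q : rat :=
  (#|[set S : {set R} | prim_nonreg S]|%:R / (2 ^ #|R|)%N%:R)%R.

End Cayley.

(* Main.v *)
Require Import Defs.
From mathcomp Require Import all_boot all_order all_algebra all_fingroup all_solvable.
From mathcomp Require Import zify.

(** Primitivity is only used to produce a nontrivial automorphism [f] fixing [1]; in
fact almost no Cayley digraph has one.  Write [n = #|R|].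

For almost every [S], each [t != 1] has many [w] with exactly one of [w], [t * w]
in [S] (order [n^(3/4)] suffices).  Taking [t = y * x^-1], many [z] see [x] and [y]
differently, so for such an [S] the automorphism [f] moves many points, and a pair
[(x, y)] with [y != f x] is refuted by many [z]: exactly one of [x * z^-1] and
[y * (f z)^-1] is in [S].

Cut [R] into few blocks, so small that most of these [z] only query [S] outside a given
block [U], and take [U] containing many points moved by [f].  A short sequence of points [z j]
then refutes all wrong pairs, so [f] is determined by [S :\: U] and the points
[z j], [f (z j)].  Since [f] preserves [S], once [S :\: U] and these points are
given, [S :&: U] loses half a bit for each point of [U] moved by [f], which is more than
the number of bits spent on the points. *)

Set Implicit Arguments.
Unset Strict Implicit.
Unset Printing Implicit Defensive.

(** * Union bound, hitting sequences and families of subsets *)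

Lemma leq_union_bound (C T : finType) (I : {set C}) (B : {set T})
    (P : C -> {set T}) (w V : nat) :
    (forall s, s \in B -> exists2 c, c \in I & s \in P c) ->
    (forall c, c \in I -> #|P c| * w <= V) ->
  #|B| * w <= #|I| * V.
Proof.
move=> coverB leP.
have leB : #|B| <= \sum_(c in I) #|P c|.
  under eq_bigr do rewrite -sum1_card.
  rewrite (exchange_big_dep xpredT) //= -sum1_card big_mkcond /=.
  apply: leq_sum => s _; case: ifP => // /coverB[c cI sP].
  by rewrite (bigD1 c) ?cI ?sP.
rewrite (leq_trans (leq_mul leB (leqnn w))) // big_distrl /=.
by rewrite -sum_nat_const; apply: leq_sum.
Qed.

Lemma leq_bernoulli (b e m : nat) :
  b ^ m.+1 + m.+1 * e * b ^ m <= (b + e) ^ m.+1.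
Proof.
elim: m => [|m IHm]; first by rewrite !expn1 expn0; lia.
rewrite [(b + e) ^ _]expnS; apply: leq_trans (leq_mul (leqnn _) IHm).
rewrite !expnS; nia.
Qed.

(** In Bernoulli's inequality with base [n - e] the second term is at least the first, as
    [n - e <= n <= e * m]. So [m] independent draws all miss a set of [e] points with probability at
    most one half. *)
Lemma leq_double_exp (n e m : nat) :
  0 < n -> e <= n -> n <= e * m -> 2 * (n - e) ^ m <= n ^ m.
Proof.
case: m => [|m] n_gt0 le_en le_n_em; first by lia.
have := leq_bernoulli (n - e) e m; rewrite subnK //.
apply: leq_trans; rewrite mul2n -addnn leq_add2l expnS leq_mul //.
by rewrite (leq_trans (leq_subr _ _)) // mulnC.
Qed.

(** A random sequence of length [m * c] misses a given [K i] with probability at most [2 ^ -c], and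
    there are fewer than [2 ^ c] indices. *)
Lemma hitting_sequence (T I : finType) (K : I -> {set T}) (m e c : nat) :
    0 < #|T| -> (forall i, e <= #|K i|) -> #|T| <= e * m -> #|I| < 2 ^ c ->
  exists z : {ffun 'I_(m * c) -> T}, forall i, exists j, z j \in K i.
Proof.
move=> T_gt0 leK leT ltI.
suff /existsP[z /forallP zK] : [exists z : {ffun 'I_(m * c) -> T},
    [forall i, [exists j, z j \in K i]]].
  by exists z => i; apply/existsP.
apply: contraLR ltI => /existsPn noz; rewrite -leqNgt.
(* With [I] empty any constant sequence works; otherwise some [K i0] shows [e <= #|T|]. *)
have [i0 _|I0] := pickP I; last first.
  have [t _|T0] := pickP T; last by move: T_gt0; rewrite (eq_card0 T0).
  have /negP[] := noz [ffun=> t].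
  by apply/forallP=> i; have := I0 i.
have le_eT : e <= #|T| := leq_trans (leK i0) (max_card _).
pose miss i : {set {ffun 'I_(m * c) -> T}} := [set z | z \in ffun_on (~: K i)].
have cov z : z \in [set: {ffun 'I_(m * c) -> T}] -> exists2 i, i \in [set: I] & z \in miss i.
  have /forallPn[i /existsPn zKi] := noz z.
  exists i; rewrite ?inE //; apply/ffun_onP=> j; rewrite inE; exact: zKi.
have lemiss i : i \in [set: I] -> #|miss i| * 2 ^ c <= #|T| ^ (m * c).
  have leC : #|~: K i| <= #|T| - e.
    by rewrite -(cardsC (K i)) leq_subRL ?leq_add2r // cardsC.
  rewrite cardsE card_ffun_on card_ord => _.
  apply: (@leq_trans ((#|T| - e) ^ (m * c) * 2 ^ c)).
    rewrite leq_mul2r; apply/orP; right.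
    by case: (posnP (m * c)) => [->|mc_gt0]; rewrite ?expn0 ?leq_exp2r.
  rewrite mulnC !expnM -expnMn.
  have [->|c_gt0] := posnP c; first by rewrite !expn0.
  by rewrite leq_exp2r // leq_double_exp.
have := leq_union_bound cov lemiss.
rewrite !cardsT card_ffun card_ord mulnC leq_pmul2r //.
by rewrite expn_gt0 T_gt0.
Qed.

(** Such a set is listed by a function from ['I_d] to [option T], padded with [None]. *)
Lemma card_small_sets (T : finType) (d : nat) :
  #|[set D : {set T} | #|D| < d]| <= #|T|.+1 ^ d.
Proof.
pose im (f : {ffun 'I_d -> option T}) := [set x | [exists i, f i == Some x]].
suff sub : [set D : {set T} | #|D| < d] \subset [set im f | f in predT].
  rewrite (leq_trans (subset_leq_card sub)) // (leq_trans (leq_imset_card _ _)) //.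
  by rewrite card_ffun card_option card_ord.
apply/subsetP=> D; rewrite inE => ltD; apply/imsetP.
exists [ffun i : 'I_d => nth None (map Some (enum D)) i] => //.
apply/setP=> x; rewrite inE; apply/idP/existsP=> [xD|[i]].
  have ltx : index x (enum D) < size (enum D) by rewrite index_mem mem_enum.
  have ltd : index x (enum D) < d by rewrite (leq_trans ltx) // -cardE ltnW.
  by exists (Ordinal ltd); rewrite ffunE (nth_map x) // nth_index ?mem_enum.
rewrite ffunE; case: (ltnP i (size (enum D))) => [lti|gei].
  by rewrite (nth_map x) // => /eqP[<-]; rewrite -mem_enum mem_nth.
by rewrite nth_default ?size_map.
Qed.

(* The rank of [g x] is below that of [x], or above it, on at least half of [X].
   Either way [S] is recovered from its trace off that half by following [g]. *)
Lemma card_coboundary (T : finType) (g : T -> T) (U X D T0 : {set T}) (e : nat) :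
    X \subset U -> (forall x, x \in X -> g x != x) -> 2 * e <= #|X| ->
  #|[set S : {set T} | (S :\: U == T0) &&
      [forall x in X, (x \in S) (+) (g x \in S) == (x \in D)]]| * 2 ^ e
    <= 2 ^ #|U|.
Proof.
move=> sXU gX leX.
have [W [h [sWX leW hW]]] : exists W : {set T}, exists h : T -> nat,
    [/\ W \subset X, e <= #|W| & forall x, x \in W -> h (g x) < h x].
  pose W1 := [set x in X | enum_rank (g x) < enum_rank x].
  pose W2 := X :\: W1.
  have := cardsID W1 X; have/setIidPr -> : W1 \subset X.
    by apply/subsetP=> x; rewrite inE => /andP[].
  rewrite -/W2 => cX.
  have [le1|lt1] := leqP e #|W1|.
    exists W1, (fun x => enum_rank x : nat); split=> //.
      by apply/subsetP=> x; rewrite inE => /andP[].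
    by move=> x; rewrite inE => /andP[].
  exists W2, (fun x => #|T| - enum_rank x); split; [exact: subsetDl|lia|].
  move=> x; rewrite !inE => /andP[+ xX]; rewrite xX /= -leqNgt => le.
  have ne : (enum_rank x : nat) != enum_rank (g x).
    by apply: contra (gX x xX) => /eqP/val_inj/enum_rank_inj<-.
  have lt : enum_rank x < enum_rank (g x) by rewrite ltn_neqAle ne.
  by apply: ltn_sub2l => //; apply: ltn_trans lt (ltn_ord _).
have sWU := subset_trans sWX sXU.
set F := [set S | _].
have injF : {in F &, injective (fun S => S :&: (U :\: W))}.
  move=> S S'; rewrite !inE => /andP[/eqP SU /forallP SD] /andP[/eqP SU' /forallP SD'] eqS.
  have off x : x \notin W -> (x \in S) = (x \in S').
    move=> xW; have [xU|xU] := boolP (x \in U).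
      by have /setP/(_ x) := eqS; rewrite !inE xW xU !andbT.
    by have := SU; rewrite -SU' => /setP/(_ x); rewrite !inE xU.
  (* Strong induction on [h]: inside [W], [g x] and [D] determine whether [x] is in the set, and
     [g x] has smaller [h]. *)
  apply/setP=> x; have [n] := ubnP (h x); elim: n x => // n IHn x.
  have [xW|/off //] := boolP (x \in W).
  have := SD x; have := SD' x; rewrite (subsetP sWX) //= => /eqP<- E lthx.
  have := IHn (g x) (leq_trans (hW x xW) lthx).
  by case: (x \in S) (x \in S') (g x \in S) (g x \in S') E => [] [] [] [].
rewrite -(card_in_imset injF).
apply: (@leq_trans (#|powerset (U :\: W)| * 2 ^ e)).
  rewrite leq_mul2r subset_leq_card ?orbT //.
  by apply/subsetP=> _ /imsetP[S _ ->]; rewrite inE subsetIr.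
rewrite card_powerset -expnD leq_exp2l // cardsDS //.
have := subset_leq_card sWU; lia.
Qed.

(** * Automorphisms fixing the identity, and discrepancies *)

Section CayleyAutomorphisms.

Variable R : finGroupType.
Implicit Types (S U : {set R}) (f : {perm R}).

Lemma digraph_aut_arc S f x y :
  f \in digraph_aut (cayley S) -> (f x * (f y)^-1 \in S)%g = (x * y^-1 \in S)%g.
Proof. by move=> /digraph_autP/(_ y x). Qed.

(** Some point [x] has a nontrivial stabilizer; conjugating by right translation by [x] moves the
    fixed point to [1]. *)
Lemma prim_nonreg_fix S : prim_nonreg S ->
  exists f, [/\ f \in digraph_aut (cayley S), f 1%g = 1%g & f != 1%g].
Proof.
case/andP=> /andP[tr _]; rewrite /regular_on tr /= => /forall_inPn[x _].
rewrite -subG1 => /subsetPn[f]; rewrite inE => /andP[fG /astab1P fx] f1.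
pose r : {perm R} := perm (@mulIg _ x).
have rE z : r z = (z * x)%g by rewrite permE.
have rG : r \in digraph_aut (cayley S).
  by apply/digraph_autP=> a b; rewrite /cayley /= !rE invMg mulgA mulgK.
exists (f ^ r^-1)%g; split.
- by rewrite groupJ ?groupV.
- by rewrite conjgE invgK !permM rE mul1g [f x]fx -{1}(mul1g x) -rE permK.
by rewrite conjg_eq1 -in_set1.
Qed.

(** This is the symmetric difference of [S] and its left translate by [t^-1]. *)
Definition discrepancy S (t : R) : {set R} :=
  [set w | (w \in S) (+) (t * w \in S)%g].

(** Substitute [w = x * z^-1], so that [y * z^-1 = (y * x^-1) * w]. *)
Lemma card_discrepancy S x y :
  #|[set z | (x * z^-1 \in S)%g (+) (y * z^-1 \in S)%g]|
    = #|discrepancy S (y * x^-1)%g|.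
Proof.
have inj : injective (fun w : R => (w^-1 * x)%g) by move=> a b /mulIg/invg_inj.
rewrite -(card_imset _ inj); apply: eq_card => z; rewrite inE.
apply/idP/imsetP=> [zP|[w + ->]].
  exists (x * z^-1)%g; last by rewrite invMg invgK mulgKV.
  by rewrite inE !mulgA mulgKV.
by rewrite inE invMg invgK !mulgA mulgV mul1g.
Qed.

(** Union bound over [t] and the small set [D] that is the discrepancy; for fixed [t] and [D],
    [card_coboundary] applies to left multiplication by [t], which has no fixed point. *)
Lemma card_low_discrepancy (d : nat) :
  #|[set S | [exists t : R, (t != 1%g) && (#|discrepancy S t| < d)]]|
      * 2 ^ #|R|./2
    <= (#|R| * #|R|.+1 ^ d) * 2 ^ #|R|.
Proof.
pose I : {set R * {set R}} := setX (~: [set 1%g]) [set D : {set R} | #|D| < d].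
pose P (c : R * {set R}) := [set S : {set R} | (S :\: setT == set0) &&
  [forall x in [set: R], (x \in S) (+) (c.1 * x \in S)%g == (x \in c.2)]].
apply: (@leq_trans (#|I| * 2 ^ #|R|)); last first.
  rewrite leq_mul2r cardsX leq_mul ?orbT ?card_small_sets //.
  exact: max_card.
apply: (@leq_union_bound _ _ I _ P) => [S|[t D]].
  rewrite inE => /existsP[t /andP[t1 ltd]].
  exists (t, discrepancy S t); first by rewrite !inE t1.
  rewrite inE setDT eqxx; apply/forall_inP=> x _ /=.
  by rewrite inE.
rewrite !inE /= => /andP[t1 _].
rewrite -[X in _ <= 2 ^ X]cardsT.
apply: card_coboundary => //.
  by move=> x _; rewrite -{2}(mul1g x) (inj_eq (mulIg x)).
by rewrite cardsT mul2n -{2}(odd_double_half #|R|) leq_addl.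
Qed.

(** * Refuting wrong images, and counting by encoding *)

(* The [z] such that [S :\: U] and [f z] alone preclude [f x = y]. *)
Definition killers S U f x y : {set R} :=
  [set z | [&& (x * z^-1 \notin U)%g, (y * (f z)^-1 \notin U)%g &
               (x * z^-1 \in S)%g (+) (y * (f z)^-1 \in S)%g]].

(** Since [f] preserves arcs, [x * z^-1] may be replaced by [f x * (f z)^-1], so at least [d] points
    [z] tell [f x] from [y]. Each of the two conditions on [U] discards at most [#|U|] of them. *)
Lemma card_killers S U f (d : nat) x y :
    f \in digraph_aut (cayley S) ->
    (forall t : R, t != 1%g -> d <= #|discrepancy S t|) -> y != f x ->
  d - 2 * #|U| <= #|killers S U f x y|.
Proof.
move=> fG good neq.
pose Z := [set z | (f x * z^-1 \in S)%g (+) (y * z^-1 \in S)%g].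
have leZ : d <= #|f @^-1: Z|.
  rewrite card_preimset; last exact: perm_inj.
  rewrite card_discrepancy good //.
  by apply: contra neq => /eqP/(canRL (mulgKV _)); rewrite mul1g => ->.
pose Z1 := [set z | (x * z^-1 \in U)%g].
pose Z2 := [set z | (y * (f z)^-1 \in U)%g].
have le1 : #|Z1| <= #|U|.
  have inj : injective (fun z : R => (x * z^-1)%g) by move=> a b /mulgI/invg_inj.
  rewrite -(card_imset Z1 inj) subset_leq_card //.
  by apply/subsetP=> _ /imsetP[z + ->]; rewrite inE.
have le2 : #|Z2| <= #|U|.
  have inj : injective (fun z : R => (y * (f z)^-1)%g).
    by move=> a b /mulgI/invg_inj/perm_inj.
  rewrite -(card_imset Z2 inj) subset_leq_card //.
  by apply/subsetP=> _ /imsetP[z + ->]; rewrite inE.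
have sub : f @^-1: Z \subset killers S U f x y :|: (Z1 :|: Z2).
  apply/subsetP=> z; rewrite !inE digraph_aut_arc //.
  by case: (_ \in U); case: (_ \in U) => //= ->.
rewrite leq_subLR addnC (leq_trans leZ) // (leq_trans (subset_leq_card sub)) //.
rewrite (leq_trans (leq_of_leqif (leq_card_setU _ _))) // leq_add2l mul2n -addnn.
by rewrite (leq_trans (leq_of_leqif (leq_card_setU _ _))) // leq_add.
Qed.

(** If [f] moves [x], a fixed point [z] of [f] cannot tell [x] from [f x]; hence all points that do
    are moved. *)
Lemma card_moved S f (d : nat) :
    f \in digraph_aut (cayley S) ->
    (forall t : R, t != 1%g -> d <= #|discrepancy S t|) -> f != 1%g ->
  d <= #|[set x | f x != x]|.
Proof.
move=> fG good f1.
have [x fx] : exists x, f x != x.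
  apply/existsP; apply: contraR f1 => /existsPn fid.
  by apply/eqP/permP=> x; rewrite perm1; apply/eqP/negPn.
have t1 : (x * (f x)^-1 != 1)%g.
  by apply: contra fx => /eqP/(canRL (mulgKV _)); rewrite mul1g => <-.
rewrite (leq_trans (good _ t1)) // -card_discrepancy subset_leq_card //.
apply/subsetP=> z; rewrite !inE; apply: contraL => /eqP fz.
by rewrite -(digraph_aut_arc x z fG) fz addbb.
Qed.

(* The [S] with an automorphism that can be read off [S :\: U], [z] and [w]. *)
Definition coded U (e k : nat) (z w : {ffun 'I_k -> R}) : {set {set R}} :=
  [set S | [exists f : {perm R},
     [&& f \in digraph_aut (cayley S), f 1%g == 1%g,
         2 * e <= #|[set x in U | f x != x]|, [forall j, f (z j) == w j] &
         [forall x, forall y, (y != f x) ==>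
            [exists j, z j \in killers S U f x y]]]]].

(** Split by the trace [T0] off [U]. All sets in one class share the automorphism [f0] of any one of
    them, hence are [f0]-invariant, and [card_coboundary] with empty [D] counts them. *)
Lemma card_coded U (e k : nat) (z w : {ffun 'I_k -> R}) :
  #|coded U e z w| * 2 ^ e <= 2 ^ #|R|.
Proof.
pose P T0 := coded U e z w :&: [set S | S :\: U == T0].
rewrite -(cardsC U) addnC expnD -card_powerset.
apply: (@leq_union_bound _ _ _ _ P) => [S SC|T0 _].
  exists (S :\: U); first by rewrite inE subsetDr.
  by rewrite inE SC inE eqxx.
have [->|[S0]] := set_0Vmem (P T0); first by rewrite cards0.
rewrite !inE => /andP[/existsP[f0 /and5P[f0G f01 lef0 /forallP f0z f0k] /eqP S0U]].
have sXU : [set x in U | f0 x != x] \subset U.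
  by apply/subsetP=> x; rewrite inE => /andP[].
apply: leq_trans (@card_coboundary _ f0 _ _ set0 T0 _ sXU _ lef0); last first.
  by move=> x; rewrite inE => /andP[].
rewrite leq_mul2r; apply/orP; right; apply/subset_leq_card/subsetP=> S.
rewrite !inE => /andP[/existsP[f /and5P[fG /eqP f1 _ /forallP fz _]] SU].
rewrite SU /=; apply/forall_inP=> x _; rewrite inE.
have off y : y \notin U -> (y \in S) = (y \in S0).
  by move=> yU; have /setP/(_ y) := S0U; rewrite -(eqP SU) !inE yU.
(* Otherwise some [z j] refutes the pair [(x, f x)] for [S0] using only points off [U], where [S]
   and [S0] agree; but [f] is an automorphism for [S]. *)
have <- : f x = f0 x.
  apply/eqP; apply: contraT => neq.
  have /forallP/(_ x)/forallP/(_ (f x)) := f0k.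
  rewrite neq /= => /existsP[j]; rewrite inE => /and3P[xU yU].
  by rewrite -!off // (eqP (f0z j)) -(eqP (fz j)) digraph_aut_arc ?addbb.
(* As [f] fixes [1], preserving the arcs from [1] means preserving [S]. *)
by have := digraph_aut_arc x 1%g fG; rewrite f1 !invg1 !mulg1 => ->; rewrite addbb.
Qed.

(** Union bound over codes: one of [p] blocks of size at most [u], a sequence of [m * c] points, and
    its image under the automorphism. *)
Lemma card_high_discrepancy (u d e m c p : nat) :
    0 < p -> #|R| <= u * p -> 2 * e * p <= d ->
    #|R| <= (d - 2 * u) * m -> #|R| ^ 2 < 2 ^ c -> 0 < u ->
  #|[set S | prim_nonreg S &&
             [forall t : R, (t != 1%g) ==> (d <= #|discrepancy S t|)]]| * 2 ^ e
    <= p * (#|R| ^ (m * c) * #|R| ^ (m * c)) * 2 ^ #|R|.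
Proof.
move=> p_gt0 le_n_up le_ed le_n_dm lt_n2c u_gt0.
pose k := m * c.
pose block (i : 'I_p) := [set x : R | enum_rank x %/ u == i].
have card_block i : #|block i| <= u.
  pose g (x : R) : option 'I_u := insub (enum_rank x %% u).
  have injg : {in block i &, injective g}.
    move=> x y; rewrite !inE => /eqP xi /eqP yi.
    rewrite /g !insubT ?ltn_pmod // => _ _ [eq_mod].
    apply/enum_rank_inj/val_inj.
    by rewrite /= (divn_eq (enum_rank x) u) (divn_eq (enum_rank y) u) xi yi eq_mod.
  rewrite -(card_in_imset injg) -[X in _ <= X]card_ord.
  rewrite -(card_imset 'I_u (@Some_inj _)) subset_leq_card //.
  apply/subsetP=> _ /imsetP[x _ ->]; rewrite /g insubT ?ltn_pmod // => lt.
  by rewrite imset_f.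
pose P (s : 'I_p * ({ffun 'I_k -> R} * {ffun 'I_k -> R})) :=
  coded (block s.1) e s.2.1 s.2.2.
have := @leq_union_bound _ _ [set: 'I_p * ({ffun 'I_k -> R} * {ffun 'I_k -> R})] _ P.
rewrite cardsT !card_prod !card_ffun !card_ord; apply; last first.
  by move=> s _; apply: card_coded.
move=> S; rewrite inE => /andP[/prim_nonreg_fix[f [fG f1 f_neq1]] /forallP good'].
have good t : t != 1%g -> d <= #|discrepancy S t| by move=> t1; have := good' t; rewrite t1.
(* Pigeonhole: at least [d >= 2 * e * p] moved points are spread over [p] blocks. *)
have [i lei] : exists i, 2 * e <= #|[set x in block i | f x != x]|.
  apply/existsP; apply: contraT => /existsPn lts.
  have le_sum : #|[set x | f x != x]| <= \sum_(i < p) #|[set x in block i | f x != x]|.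
    have lt_rank (x : R) : enum_rank x %/ u < p.
      by rewrite ltn_divLR // (leq_trans (ltn_ord _)) // mulnC.
    rewrite -sum1_card (partition_big (fun x => Ordinal (lt_rank x)) xpredT) //=.
    apply: leq_sum => i _; rewrite sum1_card subset_leq_card //.
    by apply/subsetP=> x; rewrite !inE -topredE /= !inE andbC -val_eqE.
  have lt_sum : \sum_(i < p) #|[set x in block i | f x != x]| < 2 * e * p.
    have leS (i : 'I_p) : true -> #|[set x in block i | f x != x]| + 1 <= 2 * e.
      by rewrite addn1 ltnNge lts.
    have := leq_sum (index_enum 'I_p) leS; rewrite big_split /= !sum_nat_const card_ord muln1.
    by rewrite [2 * e * p]mulnC; apply: leq_trans; rewrite -addn1 leq_add2l.
  have := leq_ltn_trans (leq_trans (card_moved fG good f_neq1) le_sum) lt_sum.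
  by rewrite ltnNge le_ed.
(* Correct pairs need no refutation; [setT] makes the hitting lemma apply to all pairs. *)
pose K (xy : R * R) := if xy.2 == f xy.1 then setT else killers S (block i) f xy.1 xy.2.
have [] := @hitting_sequence R (R * R)%type K m (d - 2 * u) c.
- by apply/card_gt0P; exists 1%g.
- move=> [x y]; rewrite /K /=; case: ifPn => [_|neq].
    have [y0 y01 | R0] := pickP (fun t : R => t != 1%g).
      by rewrite cardsT (leq_trans (leq_subr _ _)) // (leq_trans (good y0 y01)) // max_card.
    by have /eqP[] := f_neq1; apply/permP=> t; rewrite perm1 (eqP (negbFE (R0 t))) f1.
  apply: leq_trans (card_killers (block i) fG good neq).
  by rewrite leq_sub2l // leq_mul2l card_block orbT.
- by [].
- by rewrite card_prod mulnn.
move=> z hit; exists (i, (z, [ffun j => f (z j)])); rewrite ?inE //.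
apply/existsP; exists f; rewrite fG f1 eqxx lei /=; apply/andP; split.
  by apply/forallP=> j; rewrite ffunE.
apply/forallP=> x; apply/forallP=> y; apply/implyP=> neq.
by have [j] := hit (x, y); rewrite /K /= (negPf neq) => ?; apply/existsP; exists j.
Qed.

End CayleyAutomorphisms.

(** * Choice of parameters and the limit *)

Lemma leq_exp_cancel (b h a C V : nat) :
  b * 2 ^ h <= C * V -> C * 2 ^ a <= 2 ^ h -> b * 2 ^ a <= V.
Proof.
move=> leb leC; rewrite -(leq_pmul2r (expn_gt0 2 h)).
by nia.
Qed.

Lemma square_leq_exp2 (a : nat) : 30 <= a -> 5000 * a.+1 ^ 2 <= 2 ^ a.
Proof.
move=> lea; rewrite -(subnK lea); elim: (a - 30) => [|k IHk].
  rewrite add0n.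
  (* Only [2 ^ 10] is evaluated, since numerals of type [nat] are unary. *)
  have -> : 2 ^ 30 = (2 ^ 10) ^ 3 by rewrite -[30]/(10 * 3) expnM.
  have -> : 2 ^ 10 = 1024 by [].
  lia.
rewrite addSn [2 ^ _]expnS; nia.
Qed.

(** With [x = 2 ^ a], [n] is between [x ^ 4] and [16 * x ^ 4]. The threshold [d = 4 * x ^ 3]
    separates low from high discrepancy, and each case contributes a proportion of at most
    [2 ^ -a]. *)
Lemma card_prim_nonreg (R : finGroupType) (a : nat) :
    30 <= a -> 16 ^ a <= #|R| < 16 ^ a.+1 ->
  #|[set S : {set R} | prim_nonreg S]| * 2 ^ a <= 2 * 2 ^ #|R|.
Proof.
move=> lea /andP[]; set n := #|R|; set x := 2 ^ a.
have x4E : 16 ^ a = x ^ 4 by rewrite (_ : 16 = 2 ^ 4) // -!expnM mulnC.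
have n2E : 16 ^ a.+1 = 2 ^ (4 * a.+1) by rewrite (_ : 16 = 2 ^ 4) // -!expnM.
move=> len ltn.
have le_n2 : n.+1 <= 2 ^ (4 * a.+1) by rewrite -n2E.
have lex : 5000 * a.+1 ^ 2 <= x := square_leq_exp2 lea.
have x_gt0 : 0 < x by rewrite expn_gt0.
have ltn16 : n < 16 * x ^ 4 by rewrite -x4E -expnS.
pose d := 4 * x ^ 3.
pose low := [set S : {set R} | [exists t : R, (t != 1%g) && (#|discrepancy S t| < d)]].
pose high := [set S : {set R} | prim_nonreg S &&
  [forall t : R, (t != 1%g) ==> (d <= #|discrepancy S t|)]].
have cov : #|[set S : {set R} | prim_nonreg S]| <= #|low| + #|high|.
  rewrite (leq_trans _ (leq_of_leqif (leq_card_setU low high))) // subset_leq_card //.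
  apply/subsetP=> S; rewrite !inE => -> /=; rewrite -implyNb; apply/implyP.
  move=> /existsPn notlow; apply/forallP=> t; apply/implyP=> t1.
  by have := notlow t; rewrite t1 -leqNgt.
have low_le : #|low| * 2 ^ a <= 2 ^ n.
  apply: leq_exp_cancel (card_low_discrepancy R d) _.
  rewrite -/n; apply: (@leq_trans (2 ^ (4 * a.+1 * d.+1 + a))).
    rewrite expnD leq_mul2r; apply/orP; right.
    rewrite expnM expnS leq_mul ?leq_exp2r ?(ltnW le_n2) //.
    by rewrite /d muln_gt0 expn_gt0 x_gt0.
  (* Passing to [n.-1] absorbs the rounding in [n./2]. *)
  rewrite leq_exp2l // -leq_double; apply: (@leq_trans n.-1); last by lia.
  have : n >= x ^ 4 by rewrite -x4E.
  rewrite /d !expnS expn0 muln1; nia.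
have high_le : #|high| * 2 ^ a <= 2 ^ n.
  pose e := 2 ^ (2 * a - 3); pose c := 8 * a.+1.
  have eE : e * 8 = x ^ 2.
    by rewrite /e (_ : 8 = 2 ^ 3) // -expnD subnK 1?mulnC ?expnM //; lia.
  (* There are [16 * x] blocks of size at most [x ^ 3], so [d - 2 * x ^ 3 = 2 * x ^ 3] killers
     survive, and [8 * x] draws suffice to halve the misses. *)
  apply: leq_exp_cancel (@card_high_discrepancy R (x ^ 3) d e (8 * x) c (16 * x) _ _ _ _ _ _) _.
  - by rewrite muln_gt0.
  - by rewrite -/n; lia.
  - by rewrite /d; nia.
  - by rewrite -/n /d; nia.
  - rewrite -/n /c (_ : 8 * a.+1 = 4 * a.+1 * 2); last by lia.
    by rewrite expnM ltn_exp2r.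
  - by rewrite expn_gt0 x_gt0.
  rewrite -/n; set r := 8 * x * c.
  have len_exp : n ^ r <= 2 ^ (4 * a.+1 * r).
    by rewrite expnM; case: (r) => // k; rewrite leq_exp2r // ltnW.
  apply: (@leq_trans (2 ^ (4 + a + (4 * a.+1 * r + 4 * a.+1 * r) + a))).
    by move: (4 * a.+1 * r) len_exp => t len_exp; rewrite !expnD !leq_mul.
  rewrite leq_exp2l // -(leq_pmul2r (isT : 0 < 8)) eE /r /c.
  (* The two sequences cost [8 * 512 = 4096] times [a.+1 ^ 2 * x] after scaling by 8; [5000] leaves
     room for the remaining terms. *)
  apply: (@leq_trans (5000 * a.+1 ^ 2 * x)); last by rewrite -mulnn leq_mul2r lex orbT.
  have : a.+1 <= a.+1 ^ 2 * x by rewrite -mulnn -mulnA leq_pmulr // muln_gt0.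
  lia.
rewrite (leq_trans (leq_mul cov (leqnn _))) //; lia.
Qed.

Theorem theorem8p1 :
  forall eps : rat, (0 < eps)%R ->
  exists N : nat, forall R : finGroupType, (N <= #|R|)%N -> (q R < eps)%R.
Proof.
move=> eps eps_gt0.
have [k ltk] : exists k : nat, (eps^-1 < k%:R)%R.
  exists (Num.Def.archi_bound eps^-1%R); apply: Num.Theory.archi_boundP.
  by rewrite Num.Theory.invr_ge0 Order.POrderTheory.ltW.
(* The [30] meets the hypothesis of [card_prim_nonreg]; [k.+1] gives [k <= 2 ^ a.-1], the lost power
   of two absorbing the factor 2 in its bound. *)
exists (16 ^ (30 + k.+1)) => R leR.
pose a := trunc_log 16 #|R|.
have lea : 30 + k.+1 <= a by apply: trunc_log_max.
have R_gt0 : 0 < #|R| by apply: leq_trans leR; rewrite expn_gt0.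
have := @card_prim_nonreg R a (leq_trans (leq_addr _ _) lea) (trunc_log_bounds _ R_gt0).
rewrite /q; set b := #|_|; set V := 2 ^ #|R| => leb.
have V_gt0 : 0 < V by rewrite expn_gt0.
have lebk : b * k <= V.
  have : k <= 2 ^ a.-1.
    by apply: leq_trans (ltnW (ltn_expl k (isT : 1 < 2))) _; rewrite leq_exp2l //; lia.
  have : 2 ^ a = 2 * 2 ^ a.-1 by rewrite -expnS prednK //; lia.
  nia.
have k_gt0 : (0 < k%:R :> rat)%R.
  by apply: Order.POrderTheory.lt_trans ltk; rewrite Num.Theory.invr_gt0.
apply: (@Order.POrderTheory.le_lt_trans _ _ (k%:R^-1)%R).
  rewrite Num.Theory.ler_pdivrMr ?Num.Theory.ltr0n // Num.Theory.ler_pdivlMl //.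
  by rewrite -GRing.natrM Num.Theory.ler_nat mulnC.
by rewrite Num.Theory.invf_plt.
Qed.
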